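(* Let $G=(V,E,w)$ be a finite connected graph with $|V|=n\ge2$ and weights $w:E\to\mathbb{R}_{>0}$. Define $$\Gamma(G)=\max_{\substack{S\subseteq V,\ |S|\ge2\\ G[S]\text{ connected}}}\frac{|S|-1}{\operatorname{diam}_{d_G}(S)}.$$ Then $$\operatorname{OPT}_{\mathrm{card}}(G,w)\le\Gamma(G)\,\operatorname{OPT}_{\mathrm{free}}(G,w).$$
   Context: $d_G$ is the shortest-path metric of $(V,E)$ with every edge of length $1$ (weights are not lengths); $\operatorname{diam}_{d_G}(S)=\max_{a,b\in S}d_G(a,b)$. $\operatorname{OPT}_{\mathrm{free}}(G,w)$ is the minimum of $\sum_{xy\in E}w_{xy}u(x,y)$ over all ultrametrics $u$ on $V$ (metrics with $u(x,y)\le\max\{u(x,z),u(z,y)\}$) with $u\ge d_G$ on all pairs. A rooted binary hierarchy $H$ on $V$ is a rooted tree whose leaves are the vertices of $V$ and whose internal nodes have exactly two children; $C_H(x,y)$ is the set of leaves below the lowest common ancestor of $x,y$; $h_H(x,x)=0$ and $h_H(x,y)=|C_H(x,y)|-1$ for $x\ne y$. $\operatorname{OPT}_{\mathrm{card}}(G,w)$ is the minimum of $\sum_{xy\in E}w_{xy}h_H(x,y)$ over all rooted binary hierarchies $H$ on $V$ with $h_H\ge d_G$ on all pairs. *)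

(* Defs.v *)
From mathcomp Require Import boolp classical_sets reals.
From mathcomp Require Import all_boot all_order all_algebra.

Set Implicit Arguments.
Unset Strict Implicit.
Unset Printing Implicit Defensive.

Import Order.TTheory GRing.Theory Num.Theory.
Local Open Scope ring_scope.

(* A graph is a symmetric irreflexive relation [e] on a finite type [T]; the
   edge weights are a function [w : T -> T -> R] that is symmetric and
   positive on the edges (its values elsewhere are irrelevant). *)

Section Distance.
Variables (T : finType) (e : rel T).

Definition connected_graph := forall x y : T, connect e x y.

Definition walk_of_length (x y : T) (k : nat) : bool :=
  [exists p : k.-tuple T, path e x p && (last x p == y)].

(* Shortest walks have fewer than #|T| edges, so it suffices to search the
   lengths below #|T|; [gdist x y = #|T|] when y is unreachable from x. *)
Definition gdist (x y : T) : nat := find (walk_of_length x y) (iota 0 #|T|).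

Definition gdiam (S : {set T}) : nat :=
  \max_(a in S) \max_(b in S) gdist a b.

Definition induced (S : {set T}) : rel T :=
  [rel x y | [&& x \in S, y \in S & e x y]].

Definition induced_connected (S : {set T}) : bool :=
  [forall x in S, forall y in S, connect (induced S) x y].

End Distance.

(* The base value 0 of the maximum is harmless: every term is nonnegative and,
   for a connected graph on at least two vertices, the range contains setT
   (see [Gamma_max]). *)
Definition Gamma (R : realType) (T : finType) (e : rel T) : R :=
  \big[Num.max/0]_(S : {set T} | (1 < #|S|)%N && induced_connected e S)
    ((#|S|%:R - 1) / (gdiam e S)%:R).

Section Hierarchies.
Variable T : finType.

(* The left/right order of the children is not part of the mathematical
   object, but neither clusters nor costs depend on it. *)
Inductive btree : Type :=
| Leaf of T
| Node of btree & btree.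

Fixpoint leaves (H : btree) : seq T :=
  match H with
  | Leaf x => [:: x]
  | Node l r => leaves l ++ leaves r
  end.

Definition is_hierarchy (H : btree) : Prop :=
  uniq (leaves H) /\ forall x : T, x \in leaves H.

(* The subtree rooted at the lowest common ancestor of x and y. *)
Fixpoint lca (H : btree) (x y : T) : btree :=
  match H with
  | Leaf _ => H
  | Node l r =>
      if (x \in leaves l) && (y \in leaves l) then lca l x y
      else if (x \in leaves r) && (y \in leaves r) then lca r x y
      else H
  end.

Definition cluster (H : btree) (x y : T) : {set T} :=
  [set z in leaves (lca H x y)].

Definition hcard (H : btree) (x y : T) : nat :=
  if x == y then 0%N else #|cluster H x y|.-1.

End Hierarchies.

Section Costs.
Variables (R : realType) (T : finType).

Record is_metric (u : T -> T -> R) : Prop := IsMetric {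
  metric_ge0 : forall x y, 0 <= u x y;
  metric_eq0 : forall x y, u x y = 0 <-> x = y;
  metric_sym : forall x y, u x y = u y x;
  metric_triangle : forall x y z, u x y <= u x z + u z y }.

Definition is_ultrametric (u : T -> T -> R) : Prop :=
  is_metric u /\ forall x y z, u x y <= Num.max (u x z) (u z y).

Variables (e : rel T) (w : T -> T -> R).

(* Each undirected edge xy is counted once, through its orientation in which
   x precedes y in the enumeration of T. *)
Definition cost (u : T -> T -> R) : R :=
  \sum_(p : T * T | e p.1 p.2 && (enum_rank p.1 < enum_rank p.2)%N)
    w p.1 p.2 * u p.1 p.2.

Definition feasible_free (u : T -> T -> R) : Prop :=
  is_ultrametric u /\ forall x y, (gdist e x y)%:R <= u x y.

Definition feasible_card (H : btree T) : Prop :=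
  is_hierarchy H /\ forall x y, (gdist e x y <= hcard H x y)%N.

Definition hcost (H : btree T) : R := cost (fun x y => (hcard H x y)%:R).

(* Both infima are attained: see [OPT_free_min] and [OPT_card_min]. *)
Definition OPT_free : R := inf [set cost u | u in feasible_free]%classic.

Definition OPT_card : R := inf [set hcost H | H in feasible_card]%classic.

End Costs.

Section DistanceFacts.
Variables (T : finType) (e : rel T).

Lemma walkP x y k :
  reflect (exists p, [/\ path e x p, last x p = y & size p = k])
          (walk_of_length e x y k).
Proof.
apply: (iffP existsP) => [[p /andP[pp /eqP lp]]|[p [pp lp sp]]].
  by exists p; rewrite size_tuple.
have sp' : size p == k by apply/eqP.
by exists (Tuple sp'); rewrite /= pp lp eqxx.
Qed.

Lemma gdist_le_card x y : (gdist e x y <= #|T|)%N.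
Proof. by rewrite -[X in (_ <= X)%N](size_iota 0) find_size. Qed.

Lemma gdist_le_path x p : path e x p -> (gdist e x (last x p) <= size p)%N.
Proof.
move=> pp; have [lt|ge] := ltnP (size p) #|T|; last first.
  exact: leq_trans (gdist_le_card _ _) ge.
rewrite leqNgt; apply/negP => /(before_find 0%N); rewrite nth_iota // add0n.
have /walkP -> // : exists q, [/\ path e x q, last x q = last x p & size q = size p].
by exists p.
Qed.

Lemma gdist_attained x y : connect e x y ->
  exists p, [/\ path e x p, last x p = y & size p = gdist e x y].
Proof.
move=> /connectP[p0 pp0 ->]; case/shortenP: pp0 => p pp up _.
have sp : (size p < #|T|)%N.
  by have /card_uniqP := up => /= <-; exact: max_card.
apply/walkP.
have hh : has (walk_of_length e x (last x p)) (iota 0 #|T|).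
  apply/hasP; exists (size p); first by rewrite mem_iota add0n.
  by apply/walkP; exists p.
have := nth_find 0%N hh; rewrite nth_iota //.
by move: hh; rewrite has_find size_iota.
Qed.

Lemma gdistxx x : gdist e x x = 0%N.
Proof. by apply/eqP; rewrite -leqn0; exact: (@gdist_le_path x [::]). Qed.

Lemma gdist_gt0 x y : x != y -> (0 < gdist e x y)%N.
Proof.
move=> xy; rewrite lt0n; apply/eqP => d0.
have hh : has (walk_of_length e x y) (iota 0 #|T|).
  rewrite has_find -/(gdist e x y) d0 size_iota.
  by apply/card_gt0P; exists x.
have := nth_find 0%N hh; rewrite -/(gdist e x y) d0 nth_iota ?add0n; last first.
  by apply/card_gt0P; exists x.
by move=> /walkP[p [_ lp /size0nil p0]]; rewrite -lp p0 eqxx in xy.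
Qed.

Lemma gdist_lt_connected (S : {set T}) x y :
  induced_connected e S -> x \in S -> y \in S -> (gdist e x y < #|S|)%N.
Proof.
move=> /forall_inP cS xS yS.
have /forall_inP/(_ y yS)/connectP[p0 pp0 ->] := cS x xS.
case/shortenP: pp0 => p pp up _.
have pe : path e x p by apply: sub_path pp => a b /and3P[].
apply: leq_ltn_trans (gdist_le_path pe) _.
rewrite -[(size p).+1]/(size (x :: p)) -(card_uniqP up).
apply: subset_leq_card; apply/subsetP => z.
rewrite inE => /orP[/eqP->//|].
elim: p x {xS up pe} pp => //= a p IH x /andP[/and3P[_ aS _] pp].
by rewrite inE => /orP[/eqP->//|]; exact: IH pp.
Qed.

Lemma induced_connectedT : connected_graph e -> induced_connected e [set: T].
Proof.
move=> ce; apply/forall_inP => x _; apply/forall_inP => y _.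
by rewrite (@eq_connect _ _ e) // => a b; rewrite /induced /= !in_setT.
Qed.

Lemma Gamma_max (R : realType) : connected_graph e -> (1 < #|T|)%N ->
  let F (S : {set T}) : R := (#|S|%:R - 1) / (gdiam e S)%:R in
  (exists S : {set T}, [/\ (1 < #|S|)%N, induced_connected e S & Gamma R e = F S]) /\
  (forall S : {set T}, (1 < #|S|)%N -> induced_connected e S -> F S <= Gamma R e).
Proof.
move=> ce cT F; split => [|S S1 Sc]; last first.
  by apply: (@le_bigmax_cond _ _ _ _ S); rewrite S1.
have PT : (1 < #|[set: T]|)%N && induced_connected e [set: T].
  by rewrite cardsT cT induced_connectedT.
have [|S /andP[S1 Sc] ES] :=
    @eq_bigmax _ _ _ 0 [set: T] (fun S : {set T} => (1 < #|S|)%N && induced_connected e S)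
      F PT.
  move=> S /andP[S1 _]; apply: divr_ge0; last exact: ler0n.
  by rewrite subr_ge0 ler1n ltnW.
by exists S.
Qed.

End DistanceFacts.

Section Attainment.
Variables (R : realType) (T : finType) (e : rel T) (w : T -> T -> R).

Lemma inf_min (A : set R) (m : R) : A m -> lbound A m -> inf A = m.
Proof.
move=> Am lm; apply/eqP; rewrite eq_le; apply/andP; split.
  by apply: ge_inf => //; exists m.
by apply: lb_le_inf => //; exists m.
Qed.

Lemma finite_min (I : finType) (P : I -> Prop) (f : I -> R) (i0 : I) :
  P i0 -> exists2 i, P i & forall j, P j -> f i <= f j.
Proof.
move=> /asboolP Pi0.
case: (@arg_minP _ _ _ i0 (fun i => `[< P i >]) f Pi0) => i /asboolP Pi mi.
by exists i => // j /asboolP; exact: mi.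
Qed.

Hypothesis w_gt0 : forall x y, e x y -> 0 < w x y.

Lemma cost_le (u v : T -> T -> R) :
  (forall x y, u x y <= v x y) -> cost e w u <= cost e w v.
Proof.
by move=> uv; apply: ler_sum => p /andP[ep _]; rewrite ler_wpM2l // ltW ?w_gt0.
Qed.

Let nfun := {ffun T * T -> 'I_#|T|.+1}.
Let toR (g : nfun) x y : R := (val (g (x, y)))%:R.

Lemma feasible_free_round (u : T -> T -> R) : feasible_free e u ->
  exists2 g : nfun, feasible_free e (toR g) & forall x y, toR g x y <= u x y.
Proof.
move=> [[[u0 ueq us _] um] ud].
pose v x y := minn (Num.truncn (u x y)) #|T|.
have vn x y : (v x y < #|T|.+1)%N by rewrite ltnS geq_minr.
pose g : nfun := [ffun p => Ordinal (vn p.1 p.2)].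
have gE x y : toR g x y = (v x y)%:R by rewrite /toR ffunE.
have dv x y : (gdist e x y <= v x y)%N.
  by rewrite leq_min gdist_le_card truncn_ge_nat ?ud.
have vm x y z : (v x y <= maxn (v x z) (v z y))%N.
  rewrite /v -minn_maxl leq_min geq_minr andbT; apply: leq_trans (geq_minl _ _) _.
  have := um x y z; rewrite le_max => /orP[] /le_truncn le1.
    exact: leq_trans le1 (leq_maxl _ _).
  exact: leq_trans le1 (leq_maxr _ _).
exists g; last first.
  move=> x y; rewrite gE; apply: (@le_trans _ _ (Num.truncn (u x y))%:R).
    by rewrite ler_nat geq_minl.
  by rewrite truncn_le.
split; last by move=> x y; rewrite gE ler_nat.
have gm x y z : toR g x y <= Num.max (toR g x z) (toR g z y).
  have := vm x y z; rewrite leq_max !gE le_max !ler_nat; exact: id.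
split=> //; split.
- by move=> x y; rewrite gE.
- move=> x y; rewrite gE; split => [/eqP|->]; last first.
    by have /ueq := erefl y; rewrite /v => ->; rewrite truncn0 min0n.
  rewrite pnatr_eq0; have [//|xy] := eqVneq x y.
  by have := leq_trans (gdist_gt0 e xy) (dv x y); rewrite lt0n => /negPf ->.
- by move=> x y; rewrite !gE /v us.
- move=> x y z; apply: le_trans (gm x y z) _.
  by rewrite ge_max !gE lerDl lerDr !ler0n.
Qed.

Lemma feasible_free_ex : exists u : T -> T -> R, feasible_free e u.
Proof.
pose u (x y : T) : R := if x == y then 0 else #|T|%:R.
have u0 x y : 0 <= u x y by rewrite /u; case: ifP.
have um x y z : u x y <= Num.max (u x z) (u z y).
  rewrite /u le_max; have [_|xy] := eqVneq x y; first by case: ifP; rewrite ?lexx ?ler0n.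
  have [<-|_] := eqVneq x z; last by rewrite lexx.
  by rewrite (negPf xy) lexx orbT.
exists u; split; first split=> //; first split=> //.
- move=> x y; rewrite /u; have [//|xy] := eqVneq x y.
  split=> [/eqP|xy']; last by rewrite xy' eqxx in xy.
  by rewrite pnatr_eq0 => /eqP/card0_eq/(_ x).
- by move=> x y; rewrite /u eq_sym.
- by move=> x y z; apply: le_trans (um x y z) _; rewrite ge_max lerDl lerDr !u0.
move=> x y; rewrite /u; have [->|_] := eqVneq x y; first by rewrite gdistxx.
by rewrite ler_nat gdist_le_card.
Qed.

Lemma OPT_free_min :
  (exists2 u, feasible_free e u & OPT_free e w = cost e w u) /\
  (forall u, feasible_free e u -> OPT_free e w <= cost e w u).
Proof.
have [u0 /feasible_free_round[g0 fg0 _]] := feasible_free_ex.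
have [g fg gmin] :=
  @finite_min _ (fun g => feasible_free e (toR g)) (fun g => cost e w (toR g))
    g0 fg0.
have lb u : feasible_free e u -> cost e w (toR g) <= cost e w u.
  move=> /feasible_free_round[g' fg' g'u].
  exact: le_trans (gmin _ fg') (cost_le g'u).
have E : OPT_free e w = cost e w (toR g).
  by apply: inf_min => [|_ [u fu <-]]; [exists (toR g)|exact: lb].
by split; [exists (toR g)|move=> u /lb; rewrite E].
Qed.

Hypotheses (e_sym : symmetric e) (e_conn : connected_graph e).

Lemma crossing_edge (S : {set T}) a b : a \in S -> b \notin S ->
  exists c d, [/\ c \in S, d \notin S & e c d].
Proof.
move=> aS bS; have /connectP[p pp lp] := e_conn a b.
elim: p a aS pp lp => /= [a aS _ ba|c p IH a aS /andP[eac pp] lp].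
  by rewrite ba aS in bS.
by have [cS|cS] := boolP (c \in S); [exact: (IH c)|exists a, c].
Qed.

Lemma partial_hierarchy k : (0 < k <= #|T|)%N -> exists H : btree T,
  [/\ uniq (leaves H), size (leaves H) = k,
      induced_connected e [set z in leaves H] &
      {in leaves H &, forall x y, gdist e x y <= hcard H x y}%N].
Proof.
elim: k => // k IH /= kT.
have [k0|k0] := posnP k.
  have /card_gt0P[x _] : (0 < #|T|)%N by rewrite (leq_trans _ kT).
  exists (Leaf x); split=> //=; first by rewrite k0.
    apply/forall_inP => a; rewrite !inE => /eqP->.
    by apply/forall_inP => b; rewrite !inE => /eqP->.
  by move=> a b; rewrite !inE => /eqP-> /eqP->; rewrite gdistxx.
have [|H [uH sH cH dH]] := IH; first by rewrite k0 ltnW.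
set S := [set z in leaves H] in cH.
have cS : #|S| = k by rewrite cardsE -sH; apply/card_uniqP.
have [a aS] : exists a, a \in S by apply/card_gt0P; rewrite cS.
have [b bS] : exists b, b \notin S.
  apply/existsP; rewrite -negb_forall; apply/negP => /forallP all.
  have : S = setT by apply/setP => z; rewrite all inE.
  by move=> ST; move: kT; rewrite -cS ST cardsT ltnn.
have [c [d [{a aS}cinS {b bS}dS ecd]]] := crossing_edge aS bS.
have dH' : d \notin leaves H by move: dS; rewrite inE.
have S'E : [set z in leaves (Node (Leaf d) H)] = d |: S.
  by apply/setP => z; rewrite !inE.
have cS' : #|d |: S| = k.+1 by rewrite cardsU1 dS cS.
have conn' : induced_connected e (d |: S).
  have csym : connect_sym (induced e (d |: S)).
    by apply: sym_connect_sym => x y; rewrite /induced /= e_sym andbCA.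
  have toc x : x \in d |: S -> connect (induced e (d |: S)) x c.
    rewrite in_setU1 => /orP[/eqP->|xS].
      by apply: connect1; rewrite /induced /= !in_setU1 eqxx cinS orbT e_sym.
    have /forall_inP/(_ x xS)/forall_inP/(_ c cinS) := cH.
    apply: connect_sub => y z /and3P[yS zS eyz]; apply: connect1.
    by rewrite /induced /= !in_setU1 yS zS eyz !orbT.
  apply/forall_inP => x xS; apply/forall_inP => y yS.
  by apply: connect_trans (toc x xS) _; rewrite csym toc.
exists (Node (Leaf d) H); split => //=.
- by rewrite dH'.
- by rewrite sH.
- by rewrite S'E.
move=> x y xin yin; rewrite /hcard; have [->|xy] := eqVneq x y.
  by rewrite gdistxx.
rewrite /cluster /= !inE.
have -> : (x == d) && (y == d) = false.
  by apply/negP => /andP[/eqP xd /eqP yd]; rewrite xd yd eqxx in xy.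
have [/andP[xH yH]|_] := boolP ((x \in leaves H) && (y \in leaves H)).
  by have := dH x y xH yH; rewrite /hcard (negPf xy).
rewrite S'E cS' /= -ltnS -cS'; apply: gdist_lt_connected => //.
  by rewrite -S'E inE.
by rewrite -S'E inE.
Qed.

Lemma feasible_card_ex : (0 < #|T|)%N -> exists H : btree T, feasible_card e H.
Proof.
move=> T0; have [|H [uH sH _ dH]] := @partial_hierarchy #|T|; first by rewrite T0 /=.
have all x : x \in leaves H.
  have := subset_leqif_card (subset_predT (mem (leaves H))).
  have /card_uniqP -> := uH.
  by rewrite sH => -[_]; rewrite eqxx => /esym/subsetP/(_ x); exact.
by exists H; split=> [//|x y]; exact: dH.
Qed.

Lemma OPT_card_min : (0 < #|T|)%N ->
  (exists2 H, feasible_card e H & OPT_card e w = hcost e w H) /\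
  (forall H, feasible_card e H -> OPT_card e w <= hcost e w H).
Proof.
move=> T0; have [H0 fH0] := feasible_card_ex T0.
have hn (H : btree T) x y : (hcard H x y < #|T|.+1)%N.
  rewrite /hcard ltnS; case: ifP => // _.
  exact: leq_trans (leq_pred _) (max_card _).
pose g (H : btree T) : nfun := [ffun p => Ordinal (hn H p.1 p.2)].
have gE H : hcost e w H = cost e w (toR (g H)).
  by apply: eq_bigr => p _; rewrite /toR ffunE.
have [_ [H fH ->] gmin] :=
  @finite_min _ (fun f => exists2 H, feasible_card e H & f = g H)
    (fun f => cost e w (toR f)) (g H0) (ex_intro2 _ _ H0 fH0 erefl).
have lb H' : feasible_card e H' -> hcost e w H <= hcost e w H'.
  by move=> fH'; rewrite !gE; apply: gmin; exists H'.
have E : OPT_card e w = hcost e w H.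
  by apply: inf_min => [|_ [H' fH' <-]]; [exists H|exact: lb].
by split; [exists H|move=> H' /lb; rewrite E].
Qed.

End Attainment.

(* Main.v *)
Require Import Defs.
From mathcomp Require Import all_boot all_order all_algebra.
From mathcomp Require Import reals.
Import Order.TTheory GRing.Theory Num.Theory.
Local Open Scope ring_scope.

(** Run Kruskal's algorithm on the edges of G in order of increasing u, where u
   is an optimal free ultrametric, and let H be the binary tree of its merges.
   Every cluster C of H is connected in G, which gives h_H >= d_G.  When C is
   created by merging along an edge cd, the ultrametric inequality gives
   u <= u(c,d) on C, while every edge separated by this merge has
   u-value at least u(c,d).  So for an edge xy with cluster C, the diameter of
   C is at most u(x,y), whence |C| - 1 <= Gamma(G) u(x,y). *)

Section Connectivity.
Context {T : finType} {e : rel T}.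

Lemma sub_induced_connect (A B : {set T}) x y : A \subset B ->
  connect (induced e A) x y -> connect (induced e B) x y.
Proof.
move=> /subsetP AB; apply: connect_sub => a b /and3P[aA bA eab].
by apply: connect1; rewrite /induced /= !AB.
Qed.

Lemma induced_connectedP (A : {set T}) :
  reflect {in A &, forall x y, connect (induced e A) x y}
          (induced_connected e A).
Proof.
apply: (iffP forall_inP) => [cA x y xA yA|cA x xA].
  exact: (forall_inP (cA x xA)).
by apply/forall_inP => y yA; exact: cA.
Qed.

(** Every vertex of the union reaches [a]: directly inside [A], or inside [B] to [b] and then along
    the edge. *)
Lemma induced_connectedU (A B : {set T}) a b : symmetric e ->
  induced_connected e A -> induced_connected e B ->
  a \in A -> b \in B -> e a b -> induced_connected e (A :|: B).
Proof.
move=> e_sym /induced_connectedP cA /induced_connectedP cB aA bB eab.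
have csym : connect_sym (induced e (A :|: B)).
  by apply: sym_connect_sym => x y; rewrite /induced /= e_sym andbCA.
have toa x : x \in A :|: B -> connect (induced e (A :|: B)) x a.
  rewrite in_setU => /orP[xA|xB].
    by apply: sub_induced_connect (subsetUl A B) _; exact: cA.
  apply: (connect_trans (y := b)).
    by apply: sub_induced_connect (subsetUr A B) _; exact: cB.
  by apply: connect1; rewrite /induced /= !in_setU aA bB orbT e_sym.
apply/induced_connectedP => x y xAB yAB.
by apply: connect_trans (toa x xAB) _; rewrite csym toa.
Qed.

End Connectivity.

Section Kruskal.
Context {R : realType} {T : finType}.
Variables (e : rel T) (u : T -> T -> R).
Hypotheses (e_sym : symmetric e) (e_conn : connected_graph e).
Hypothesis u_ultra : is_ultrametric u.

(** Connectedness is asked for all pairs, as feasibility must hold on all of them; the bound on [u]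
    only for edges, as only edges enter the cost. *)
Definition merge_tree (H : btree T) : Prop :=
  [/\ uniq (leaves H), induced_connected e [set z in leaves H] &
   {in leaves H &, forall x y, x != y ->
      induced_connected e (cluster H x y) /\
      (e x y -> {in cluster H x y &, forall a b, u a b <= u x y})}].

Lemma merge_tree_Leaf x : merge_tree (Leaf x).
Proof.
split=> //=; last first.
  by move=> a b; rewrite !inE => /eqP-> /eqP->; rewrite eqxx.
by apply/induced_connectedP => a b; rewrite !inE => /eqP-> /eqP->.
Qed.

(** A pair across [A] and [B] is compared along [a], [c], [d], [b] by two uses of the strong
    triangle inequality. *)
Lemma ultrametric_join (A B : {pred T}) c d r :
  {in A &, forall a b, u a b <= r} -> {in B &, forall a b, u a b <= r} ->
  c \in A -> d \in B -> u c d <= r ->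
  {in [predU A & B] &, forall a b, u a b <= r}.
Proof.
have [[_ _ us _] um] := u_ultra; move=> hA hB cA dB ucd.
have cross a b : a \in A -> b \in B -> u a b <= r.
  move=> aA bB; apply: le_trans (um a b c) _; rewrite ge_max hA //=.
  by apply: le_trans (um c b d) _; rewrite ge_max ucd hB.
move=> a b /orP[aA|aB] /orP[bA|bB].
- exact: hA.
- exact: cross.
- by rewrite us cross.
- exact: hB.
Qed.

(** Only pairs separated at the root are new. Their cluster is the whole tree, and for such an edge
    [x y] the value [u c d] lies between the [u]-diameter of the cluster and [u x y]. *)
Lemma merge_tree_Node l r c d :
  merge_tree l -> merge_tree r -> ~~ has [in leaves l] (leaves r) ->
  c \in leaves l -> d \in leaves r -> e c d ->
  {in leaves (Node l r) &, forall a b, u a b <= u c d} ->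
  {in leaves l & leaves r, forall a b, e a b -> u c d <= u a b} ->
  merge_tree (Node l r).
Proof.
move=> [ul cl gl] [ur cr gr] dis cL dR ecd small big.
have Ncl : induced_connected e [set z in leaves (Node l r)].
  have -> : [set z in leaves (Node l r)]
      = [set z in leaves l] :|: [set z in leaves r].
    by apply/setP => z; rewrite !inE mem_cat.
  by apply: (induced_connectedU _ _ c d) => //; rewrite inE.
split=> //=; first by rewrite cat_uniq ul ur dis.
move=> x y xN yN xy; rewrite /cluster /=.
have [/andP[xl yl]|nl] := boolP ((x \in leaves l) && (y \in leaves l)).
  exact: gl.
have [/andP[xr yr]|nr] := boolP ((x \in leaves r) && (y \in leaves r)).
  exact: gr.
split=> // exy a b; rewrite !inE => aN bN.
apply: le_trans (small _ _ aN bN) _.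
have [[_ _ us _] _] := u_ultra.
move: xN yN nl nr; rewrite !mem_cat.
case xl: (x \in leaves l); case yl: (y \in leaves l) => //= xr yr _.
- by move=> _; exact: big.
- by move=> _; rewrite (us x) big // e_sym.
- by rewrite xr yr.
Qed.

(* A forest is represented by the map sending each vertex to its tree. *)
Definition kruskal_forest (f : T -> btree T) : Prop :=
  [/\ forall x, x \in leaves (f x),
      forall x y, y \in leaves (f x) -> f y = f x,
      forall x, merge_tree (f x) &
      forall x a b, e a b -> b \notin leaves (f a) ->
        {in leaves (f x) &, forall c d, u c d <= u a b}].

Lemma kruskal_forest_Leaf : kruskal_forest (@Leaf T).
Proof.
have [[u0 ueq _ _] _] := u_ultra.
split=> [x|x y|x|x a b _ _ c d]; rewrite /= ?inE //.
- by move/eqP->.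
- exact: merge_tree_Leaf.
- by move=> /eqP-> /eqP->; rewrite (ueq x x).2.
Qed.

Definition merge (f : T -> btree T) c d z : btree T :=
  if z \in leaves (Node (f c) (f d)) then Node (f c) (f d) else f z.

(** The last clause of [kruskal_forest] is the trace of the increasing order: no edge between two
    trees is below the [u]-diameter of any tree. Minimality of [u c d] preserves it. The second
    conclusion makes the termination measure of [kruskal_tree] decrease. *)
Lemma kruskal_forest_merge f c d :
  kruskal_forest f -> e c d -> d \notin leaves (f c) ->
  (forall a b, e a b -> b \notin leaves (f a) -> u c d <= u a b) ->
  kruskal_forest (merge f c d) /\
  forall x y, y \in leaves (f x) -> y \in leaves (merge f c d x).
Proof.
move=> [fx fE fm fu] ecd dc mincd.
have dis : ~~ has [in leaves (f c)] (leaves (f d)).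
  apply/hasPn => z /fE zd; apply/negP => /fE zc.
  by move: dc; rewrite -zc zd fx.
(* The edge [c d] itself joins two trees, so [fu] bounds both of them by [u c d]. *)
have small : {in leaves (Node (f c) (f d)) &, forall a b, u a b <= u c d}.
  move=> a b; rewrite /= !mem_cat.
  by apply: (ultrametric_join [in leaves (f c)] [in leaves (f d)] c d) => //;
    exact: fu.
have mono x y : y \in leaves (f x) -> y \in leaves (merge f c d x).
  rewrite /merge; case: ifP => // + yx.
  by rewrite /= !mem_cat => /orP[] /fE <-; rewrite yx ?orbT.
split=> //; split.
- by move=> x; exact: mono.
- move=> x y; rewrite /merge; case: ifP => [_ ->//|xN yx].
  case: ifP => [|_]; last exact: fE.
  move: xN; rewrite /= !mem_cat => + /orP[] /fE yc.
    by rewrite -yc (fE _ _ yx) fx.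
  by rewrite -yc (fE _ _ yx) fx orbT.
- move=> x; rewrite /merge; case: ifP => // _.
  apply: (@merge_tree_Node _ _ c d) => // a b aC bD eab.
  apply: mincd => //; apply/negP => bA.
  move/hasPn: dis => /(_ b bD) /negP; apply.
  by rewrite -(fE _ _ aC).
(* Trees only grow, so an edge between two trees after the merge was one before it. *)
- move=> x a b eab nb; have {}nb : b \notin leaves (f a).
    by apply: contra nb; exact: mono.
  rewrite /merge; case: ifP => [_ p q pN qN|_]; last exact: fu.
  exact: le_trans (small _ _ pN qN) (mincd _ _ eab nb).
Qed.

(** Induction on the number of ordered pairs lying in different trees. *)
Lemma kruskal_tree (x0 : T) :
  exists2 H, merge_tree H & forall x, x \in leaves H.
Proof.
pose split_pairs f := [set p : T * T | p.2 \notin leaves (f p.1)].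
suff main n f : (#|split_pairs f| < n)%N -> kruskal_forest f ->
    exists2 H, merge_tree H & forall x, x \in leaves H.
  exact: main _ _ (ltnSn _) kruskal_forest_Leaf.
elim: n f => // n IH f fn kf; have [fx fE fm fu] := kf.
have [/forallP all|] := boolP [forall x, x \in leaves (f x0)].
  by exists (f x0).
rewrite negb_forall => /existsP[y0 ny0].
(* Connectedness of the graph supplies an edge between two trees, so that a [u]-minimal one
   exists. *)
have [c [d [cx dx ecd]]] : exists c d,
    [/\ c \in leaves (f x0), d \notin leaves (f x0) & e c d].
  have xS : x0 \in [set z in leaves (f x0)] by rewrite inE.
  have yS : y0 \notin [set z in leaves (f x0)] by rewrite inE.
  have [c [d]] := crossing_edge e_conn xS yS.
  by rewrite !inE; exists c, d.
pose cut (p : T * T) := e p.1 p.2 && (p.2 \notin leaves (f p.1)).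
have cutcd : cut (c, d) by rewrite /cut /= ecd (fE _ _ cx) dx.
case: (@arg_minP _ _ _ (c, d) cut (fun p => u p.1 p.2) cutcd).
move=> -[a b] /andP[/= eab nab] minab.
have [|kg mono] := kruskal_forest_merge _ _ _ kf eab nab.
  by move=> p q epq npq; apply: (minab (p, q)); rewrite /cut /= epq.
apply: IH kg; rewrite -ltnS; apply: leq_trans fn; rewrite ltnS.
apply: proper_card; apply/properP; split.
  by apply/subsetP => -[p q]; rewrite !inE /=; apply: contra; exact: mono.
(* The ends of the merged edge now share a tree, so the decrease is strict. *)
exists (a, b); first by rewrite inE.
by rewrite inE negbK /merge /= mem_cat fx /= mem_cat fx orbT.
Qed.

End Kruskal.

Lemma lca_mem (T : finType) (H : btree T) x y :
  x \in leaves H -> y \in leaves H ->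
  (x \in leaves (lca H x y)) && (y \in leaves (lca H x y)).
Proof.
elim: H => [z|l IHl r IHr] /= xH yH; first by rewrite xH.
case: ifP => [/andP[]|_]; first exact: IHl.
case: ifP => [/andP[]|_]; first exact: IHr.
by rewrite /= xH.
Qed.

Lemma gdiam_le (R : realType) (T : finType) (e : rel T) (S : {set T}) (t : R) :
  0 <= t -> {in S &, forall a b, (gdist e a b)%:R <= t} ->
  (gdiam e S)%:R <= t.
Proof.
move=> t0 h; rewrite /gdiam; elim/big_ind: _ => // [m n mt nt|a aS].
  by case: (leqP m n).
elim/big_ind: _ => // [m n mt nt|b bS]; last exact: h.
by case: (leqP m n).
Qed.

(** Needed to clear the denominator in [Gamma], since division by zero yields 0. *)
Lemma gdiam_gt0 (T : finType) (e : rel T) (S : {set T}) a b :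
  a \in S -> b \in S -> a != b -> (0 < gdiam e S)%N.
Proof.
move=> aS bS ab; apply: leq_trans (gdist_gt0 e ab) _.
apply: leq_trans (leq_bigmax_cond a aS).
exact: (leq_bigmax_cond (F := gdist e a) b bS).
Qed.

Theorem corollary21 (R : realType) (T : finType) (e : rel T) (w : T -> T -> R)
    (e_sym : symmetric e) (e_irr : irreflexive e) (e_conn : connected_graph e)
    (card_T : (2 <= #|T|)%N)
    (w_sym : forall x y, e x y -> w x y = w y x)
    (w_gt0 : forall x y, e x y -> 0 < w x y) :
  OPT_card e w <= Gamma R e * OPT_free e w.
Proof.
have [[u [uu du] ->] _] := OPT_free_min w_gt0.
have T0 : (0 < #|T|)%N by exact: ltnW.
have [x0 _] : exists x : T, x \in T by apply/card_gt0P.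
have [H [uH _ mH] allH] := kruskal_tree e u e_sym e_conn uu x0.
have cl x y : (x \in cluster H x y) && (y \in cluster H x y).
  by rewrite !inE; apply: lca_mem.
have fH : feasible_card e H.
  split=> // x y; rewrite /hcard; have [->|xy] := eqVneq x y.
    by rewrite gdistxx.
  have [cC _] := mH x y (allH x) (allH y) xy; have /andP[xC yC] := cl x y.
  (* A shortest path is no longer than a simple path inside the connected cluster, which has at most
     |C| - 1 edges. *)
  have lt := gdist_lt_connected cC xC yC.
  by rewrite -ltnS (ltn_predK lt).
have [_ Gmax] := Gamma_max R e_conn card_T.
apply: le_trans ((OPT_card_min w e_sym e_conn T0).2 H fH) _.
(* The costs are compared edge by edge. *)
rewrite /hcost /cost mulr_sumr; apply: ler_sum => -[x y] /andP[/= exy _].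
rewrite mulrCA ler_wpM2l ?(ltW (w_gt0 _ _ exy)) //.
have xy : x != y by apply/eqP => xy; rewrite xy e_irr in exy.
have [cC /(_ exy) uC] := mH x y (allH x) (allH y) xy.
have /andP[xC yC] := cl x y.
have C1 : (1 < #|cluster H x y|)%N by apply/card_gt1P; exists x, y.
have diam0 : 0 < (gdiam e (cluster H x y))%:R :> R.
  by rewrite ltr0n (gdiam_gt0 _ e _ x y).
have := Gmax _ C1 cC; rewrite ler_pdivrMr // => leC.
rewrite /hcard (negPf xy) -subn1 natrB; last exact: ltnW.
apply: le_trans leC _.
(* It remains to bound the diameter by [u x y]: on the cluster, [gdist] is at most [u] and [u] is at
   most [u x y]. *)
have G0 : 0 <= Gamma R e by exact: bigmax_ge_id.
rewrite ler_wpM2l // gdiam_le //; first by have [[u0 _ _ _] _] := uu.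
by move=> a b aC bC; apply: le_trans (du a b) (uC _ _ aC bC).
Qed.
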